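(* Let $\mathcal A=\{a_1,a_2\}$, let $w=w_0w_1w_2\ldots$ be a one-sided infinite fixed word of a substitution on $\mathcal A$, and let the tile lengths $|I_1|,|I_2|>0$ (for $a_1,a_2$ respectively) be algebraic numbers. Let $0=t_0<t_1<\cdots$ be the geometric realisation of $w$ and $G(X)=\sum_{n\ge0}t_nX^n$. Then exactly one of the following holds: (a) $|I_1|=|I_2|$; in this case $G(X)=\frac{|I_1|X}{(1-X)^2}$. (b) $|I_1|\ne|I_2|$ and $w$ is eventually periodic; in this case there exist $P\in\mathbb{Q}[X]$ and an integer $d\ge1$ such that \[G(X)=(|I_1|-|I_2|)\frac{XP(X)}{(1-X)(1-X^d)}+|I_1|\frac{X}{(1-X)^2}.\] (c) $|I_1|\ne|I_2|$ and $w$ is not eventually periodic; in this case $G(X)$ is transcendental over $\mathbb{Q}(X)$.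
   Context: The geometric realisation of $w$: replace each letter $w_n=a_j$ by a translated copy of an interval $I_j$ of length $|I_j|$, placed consecutively starting at the origin and proceeding to the right with no gaps, in the order $w_0,w_1,\dots$; $t_n$ is the left endpoint of the interval corresponding to $w_n$. A word is eventually periodic if there exist $N$, $d\ge1$ with $w_{n+d}=w_n$ for all $n\ge N$. Transcendence over $\mathbb{Q}(X)$ is meant inside $\mathbb{C}((X))$. *)

(* Defs.v *)
From HB Require Import structures.
From mathcomp Require Import all_boot all_order all_algebra all_field.
Set Implicit Arguments. Unset Strict Implicit. Unset Printing Implicit Defensive.
Import Order.TTheory GRing.Theory Num.Theory.
Local Open Scope ring_scope.

Inductive letter := a1 | a2.

Definition substitution := letter -> seq letter.
Definition nonerasing (sigma : substitution) := forall a, (0 < size (sigma a))%N.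

(* w : nat -> letter is a (one-sided infinite) fixed word of sigma:
   sigma(w_0) sigma(w_1) ... = w, i.e. every finite concatenation
   sigma(w_0)...sigma(w_{n-1}) is a prefix of w (with sigma non-erasing,
   these prefixes exhaust sigma(w)). *)
Definition fixed_word (sigma : substitution) (w : nat -> letter) :=
  nonerasing sigma /\
  forall n i, let u := flatten [seq sigma (w k) | k <- iota 0 n] in
    (i < size u)%N -> nth a1 u i = w i.

Definition eventually_periodic (w : nat -> letter) :=
  exists N d, (1 <= d)%N /\ forall n, (N <= n)%N -> w (n + d)%N = w n.

Definition tile_len (l1 l2 : algC) (a : letter) : algC :=
  match a with a1 => l1 | a2 => l2 end.

Definition geom_real (l1 l2 : algC) (w : nat -> letter) (n : nat) : algC :=
  \sum_(k < n) tile_len l1 l2 (w k).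

(* Formal power series over algC (a subring of C[[X]] subset C((X))). *)
Definition series := nat -> algC.
Definition smul (f g : series) : series :=
  fun n => \sum_(i < n.+1) f i * g (n - i)%N.
Definition spoly (p : {poly algC}) : series := fun n => p`_n.
Definition spow (f : series) (k : nat) : series := iter k (smul f) (spoly 1).

(* f is algebraic over Q(X): there is a nonzero polynomial Q(X,Y) in Q(X)[Y];
   after clearing denominators Q in Q[X][Y], with Q(X, f(X)) = 0. *)
Definition algebraic_over_QX (f : series) :=
  exists Q : {poly {poly rat}}, Q != 0 /\
    forall n, \sum_(k < size Q) smul (spoly (map_poly ratr Q`_k)) (spow f k) n = 0.
Definition transcendental_over_QX (f : series) := ~ algebraic_over_QX f.

(* Main.v *)
Require Import Defs.
From HB Require Import structures.
From mathcomp Require Import all_boot all_order all_algebra all_field.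
From mathcomp Require Import boolp ring.
Import Order.TTheory GRing.Theory Num.Theory.
Set Implicit Arguments. Unset Strict Implicit. Unset Printing Implicit Defensive.
Local Open Scope ring_scope.

(** Put [g := (1 - X) G]; its coefficients are [0] followed by the tile lengths
    [l1], [l2] read along [w], so they take finitely many values, and [g] is
    algebraic as soon as [G] is.  An algebraic series satisfies a linear
    differential equation [\sum_k p_k (R X d/dX)^k g = 0] with polynomial [R] and
    [p_k].  The [n]-th coefficient of the term of order [k] is [n^k] times that of
    [p_k R^k g], up to [O(n^(k-1))]; hence for the largest [k] with [p_k <> 0] the
    coefficients of [p_k R^k g] are [O(1/n)].  They range over a finite set, so
    they vanish eventually, [g] is rational, and a linear recurrence with finitely
    many values is eventually periodic by the pigeonhole principle. *)

(** * The ring of formal power series *)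

Definition fps (K : Type) := nat -> K.
HB.instance Definition _ (K : Type) := gen_eqMixin (fps K).
HB.instance Definition _ (K : Type) := gen_choiceMixin (fps K).

Definition fps_mul (K : idomainType) (f g : fps K) : fps K :=
  fun n => \sum_(i < n.+1) f i * g (n - i)%N.
Definition fps_poly (K : idomainType) (p : {poly K}) : fps K := fun n => p`_n.
Definition fps_trunc (K : idomainType) (m : nat) (f : fps K) : {poly K} := \poly_(i < m) f i.

Lemma coef_fps_trunc (K : idomainType) m (f : fps K) n :
  (n < m)%N -> (fps_trunc m f)`_n = f n.
Proof. by rewrite coef_poly => ->. Qed.

(** Only coefficients of index at most [n] enter the [n]-th coefficient of a product, so ring axioms
    can be checked on polynomial truncations. *)
Lemma fps_mul_coef (K : idomainType) (p q : {poly K}) (f g : fps K) n :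
  (forall i, (i <= n)%N -> f i = p`_i) -> (forall i, (i <= n)%N -> g i = q`_i) ->
  fps_mul f g n = (p * q)`_n.
Proof.
move=> fp gq; rewrite coefM; apply: eq_bigr => i _.
by rewrite fp ?gq ?leq_subr // -ltnS.
Qed.

Lemma fps_mul_trunc (K : idomainType) (f g : fps K) m n : (n < m)%N ->
  fps_mul f g n = (fps_trunc m f * fps_trunc m g)`_n.
Proof.
by move=> ltnm; apply: fps_mul_coef => i lein; rewrite coef_fps_trunc // (leq_ltn_trans lein).
Qed.

Section FpsRing.
Variable K : idomainType.
Implicit Types f g h : fps K.

Definition fps_zero : fps K := fun=> 0.
Definition fps_opp f : fps K := fun n => - f n.
Definition fps_add f g : fps K := fun n => f n + g n.

Fact fps_addA : associative fps_add.
Proof. by move=> f g h; apply: funext => n; apply: addrA. Qed.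
Fact fps_addC : commutative fps_add.
Proof. by move=> f g; apply: funext => n; apply: addrC. Qed.
Fact fps_add0 : left_id fps_zero fps_add.
Proof. by move=> f; apply: funext => n; apply: add0r. Qed.
Fact fps_addN : left_inverse fps_zero fps_opp fps_add.
Proof. by move=> f; apply: funext => n; apply: addNr. Qed.

HB.instance Definition _ := GRing.isZmodule.Build (fps K)
  fps_addA fps_addC fps_add0 fps_addN.

Lemma fpsD f g n : (f + g) n = f n + g n. Proof. by []. Qed.
Lemma fpsN f n : (- f) n = - f n. Proof. by []. Qed.
Lemma fps0 n : (0 : fps K) n = 0. Proof. by []. Qed.

Fact fps_mulA : associative (@fps_mul K).
Proof.
move=> f g h; apply: funext => n; pose p := @fps_trunc K n.+1.
rewrite (@fps_mul_coef _ (p f) (p g * p h)).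
- rewrite (@fps_mul_coef _ (p f * p g) (p h)) ?mulrA // => i lein.
    exact: fps_mul_trunc.
  by rewrite coef_fps_trunc.
- by move=> i lein; rewrite coef_fps_trunc.
- by move=> i lein; exact: fps_mul_trunc.
Qed.

Fact fps_mulC : commutative (@fps_mul K).
Proof.
by move=> f g; apply: funext => n; rewrite !(@fps_mul_trunc _ _ _ n.+1) // mulrC.
Qed.

Fact fps_mul1 : left_id (fps_poly 1) (@fps_mul K).
Proof.
move=> f; apply: funext => n; rewrite (@fps_mul_coef _ 1 (fps_trunc n.+1 f)) //.
  by rewrite mul1r coef_fps_trunc.
by move=> i lein; rewrite coef_fps_trunc.
Qed.

Fact fps_mulDl : left_distributive (@fps_mul K) +%R.
Proof.
move=> f g h; apply: funext => n; rewrite fpsD /fps_mul -big_split.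
by apply: eq_bigr => i _; rewrite fpsD mulrDl.
Qed.

Fact fps_oner_neq0 : fps_poly 1 != 0 :> fps K.
Proof.
apply/eqP => /(congr1 (fun f : fps K => f 0%N)) /eqP.
by rewrite /fps_poly fps0 coef1 oner_eq0.
Qed.

HB.instance Definition _ := GRing.Zmodule_isComNzRing.Build (fps K)
  fps_mulA fps_mulC fps_mul1 fps_mulDl fps_oner_neq0.

Lemma fpsM f g n : (f * g) n = \sum_(i < n.+1) f i * g (n - i)%N.
Proof. by []. Qed.

Fact fps_poly_is_zmod_morphism : zmod_morphism (@fps_poly K).
Proof. by move=> p q; apply: funext => n; rewrite /fps_poly coefB. Qed.

Fact fps_poly_is_monoid_morphism : monoid_morphism (@fps_poly K).
Proof.
split=> [//|p q]; apply: funext => n.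
by rewrite /fps_poly coefM.
Qed.

HB.instance Definition _ := GRing.isZmodMorphism.Build _ _ (@fps_poly K)
  fps_poly_is_zmod_morphism.
HB.instance Definition _ := GRing.isMonoidMorphism.Build _ _ (@fps_poly K)
  fps_poly_is_monoid_morphism.

Lemma fps_polyX_mul f n : (fps_poly 'X * f) n = if n is m.+1 then f m else 0.
Proof.
rewrite fpsM big_ord_recl /fps_poly coefX mul0r add0r.
case: n => [|n]; first by rewrite big_ord0.
rewrite big_ord_recl coefX mul1r subn1 big1 ?addr0 // => i _.
by rewrite coefX mul0r.
Qed.

Lemma fps_polyC_mul c f n : (fps_poly c%:P * f) n = c * f n.
Proof.
rewrite fpsM big_ord_recl /fps_poly coefC subn0 big1 ?addr0 // => i _.
by rewrite coefC mul0r.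
Qed.

Lemma fps_poly_inj : injective (@fps_poly K).
Proof. by move=> p q /(congr1 (fun f : fps K => f _)) pq; apply/polyP => i; apply: pq. Qed.

Lemma fps_neq0P f : f != 0 -> exists2 n, f n != 0 & forall i, (i < n)%N -> f i = 0.
Proof.
move=> f0; have ex : exists n, f n != 0.
  apply: contrapT => nex; case/eqP: f0; apply: funext => n.
  by apply/eqP/negPn/negP => fn; apply: nex; exists n.
case: (ex_minnP ex) => n fn min; exists n => // i ltin.
by apply/eqP/negPn/negP => /min; rewrite leqNgt ltin.
Qed.

(** At the sum of the orders of two nonzero series, the product has as coefficient the product of
    their lowest nonzero coefficients. *)
Lemma fps_mul_eq0 f g : f * g = 0 -> f = 0 \/ g = 0.
Proof.
move=> fg; case: (eqVneq f 0) => [|/fps_neq0P[m fm ltm]]; first by left.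
case: (eqVneq g 0) => [|/fps_neq0P[n gn ltn]]; first by right.
have /eqP := congr1 (fun h : fps K => h (m + n)%N) fg.
have ltmS : (m < (m + n).+1)%N by rewrite ltnS leq_addr.
rewrite fpsM (bigD1 (Ordinal ltmS)) //= addKn big1 => [|i].
  by rewrite fps0 addr0 mulf_eq0 (negPf fm) (negPf gn).
rewrite -val_eqE /= neq_ltn => /orP[/ltm->|lti]; first by rewrite mul0r.
by rewrite ltn ?mulr0 // ltn_subLR ?ltn_add2r // -ltnS.
Qed.

End FpsRing.

(** * The Euler derivation and polynomial relations satisfied by a series *)

Section Euler.
Variable K : idomainType.
Implicit Types (f g : fps K) (p : {poly K}) (A : {poly {poly K}}).

Definition fps_euler f : fps K := fun n => f n *+ n.
Definition poly_euler p : {poly K} := 'X * p^`().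

Lemma fps_eulerD f g : fps_euler (f + g) = fps_euler f + fps_euler g.
Proof. by apply: funext => n; rewrite /fps_euler !fpsD mulrnDl. Qed.

Lemma fps_eulerM f g : fps_euler (f * g) = fps_euler f * g + f * fps_euler g.
Proof.
apply: funext => n; rewrite fpsD /fps_euler !fpsM -sumrMnl -big_split.
apply: eq_bigr => i _ /=; rewrite mulrnAl mulrnAr -mulrnDr subnKC //.
by rewrite -ltnS.
Qed.

Lemma fps_euler_poly p : fps_euler (fps_poly p) = fps_poly (poly_euler p).
Proof.
apply: funext => -[|n]; rewrite /fps_euler /fps_poly coefXM ?mulr0n //.
by rewrite coef_deriv.
Qed.

Definition fps_eval f A : fps K := (map_poly (@fps_poly K) A).[f].

Fact fps_eval_is_zmod_morphism f : zmod_morphism (fps_eval f).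
Proof. by move=> A B; rewrite /fps_eval rmorphB hornerD hornerN. Qed.

Fact fps_eval_is_monoid_morphism f : monoid_morphism (fps_eval f).
Proof.
by split=> [|A B]; rewrite /fps_eval ?rmorph1 ?hornerE // rmorphM hornerM.
Qed.

HB.instance Definition _ f := GRing.isZmodMorphism.Build _ _ (fps_eval f)
  (fps_eval_is_zmod_morphism f).
HB.instance Definition _ f := GRing.isMonoidMorphism.Build _ _ (fps_eval f)
  (fps_eval_is_monoid_morphism f).

Lemma fps_evalX f : fps_eval f 'X = f.
Proof. by rewrite /fps_eval map_polyX hornerX. Qed.

Lemma fps_evalC f p : fps_eval f p%:P = fps_poly p.
Proof. by rewrite /fps_eval map_polyC hornerC. Qed.

Lemma fps_evalZ f p A : fps_eval f (p *: A) = fps_poly p * fps_eval f A.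
Proof. by rewrite -mul_polyC rmorphM /= fps_evalC. Qed.

(** Chain rule for [X d/dX] on [K[X][Y]] at [Y = f]: the first term differentiates the coefficients
    in [X], the second the outer variable [Y]. *)
Lemma fps_euler_eval f A : fps_euler (fps_eval f A) =
  fps_eval f (map_poly poly_euler A) + fps_eval f A^`() * fps_euler f.
Proof.
have pe0 : poly_euler 0 = 0 by rewrite /poly_euler deriv0 mulr0.
elim/poly_ind: A => [|A c IH].
  rewrite map_poly0 deriv0 !rmorph0 mul0r addr0.
  by apply: funext => n; rewrite /fps_euler fps0 mul0rn.
have -> : map_poly poly_euler (A * 'X + c%:P) =
    map_poly poly_euler A * 'X + (poly_euler c)%:P.
  apply/polyP => i; rewrite coef_map_id0 // !(coefD, coefMX, coefC).
  by case: i => [|i] /=; rewrite ?add0r // !addr0 coef_map_id0.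
rewrite !(derivD, derivM, derivX, derivC) !(rmorphD, rmorphM) /=.
rewrite !(fps_evalX, fps_evalC) rmorph1 rmorph0 fps_eulerD fps_eulerM IH fps_euler_poly.
rewrite [poly_euler c]/poly_euler rmorphM !mulrDl mul0r addr0 mulr1 -!addrA.
by congr (_ + _); rewrite addrA [LHS]addrC mulrAC.
Qed.

(** Least degree in [Y] stands in for the minimal polynomial over [K(X)], while all coefficients
    stay in [K[X]]. *)
Lemma minimal_annihilator f : (exists2 A, A != 0 & fps_eval f A = 0) ->
  exists Q, [/\ Q != 0, fps_eval f Q = 0 &
    forall A, (size A < size Q)%N -> fps_eval f A = 0 -> A = 0].
Proof.
move=> [A0 A0n0 evA0].
pose P n := `[< exists A, [/\ size A = n, A != 0 & fps_eval f A = 0] >].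
have exP : exists n, P n by exists (size A0); apply/asboolP; exists A0.
case: (ex_minnP exP) => n /asboolP[Q [szQ Qn0 evQ]] min; exists Q; split=> // A ltA evA.
apply/eqP/negPn/negP => An0; move: ltA; rewrite szQ ltnNge => /negP; apply.
by apply: min; apply/asboolP; exists A.
Qed.

(* The pseudo-remainders of the [A k] modulo [Q] have at most [size Q - 1]
   coefficients, so [size Q] of them are linearly dependent over [K[X]]. *)
Lemma eval_linear_dependence f (Q : {poly {poly K}}) (A : nat -> {poly {poly K}}) :
  Q != 0 -> fps_eval f Q = 0 ->
  exists p : nat -> {poly K}, (exists2 k, (k < size Q)%N & p k != 0) /\
    \sum_(k < size Q) fps_poly (p k) * fps_eval f (A k) = 0.
Proof.
move=> Qn0 evQ; set m := size Q; pose r (k : nat) := A k %% Q.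
have szr k : (size (r k) < m)%N by rewrite Pdiv.Idomain.ltn_modp.
have evr k : fps_eval f (r k) =
    fps_poly (lead_coef Q ^+ scalp (A k) Q) * fps_eval f (A k).
  by rewrite -fps_evalZ Pdiv.Idomain.divp_eq rmorphD rmorphM /= evQ mulr0 add0r.
pose M : 'M[{poly K}]_m := \matrix_(i, j) (r i)`_j.
have m_gt0 : (m.-1 < m)%N by rewrite prednK // lt0n size_poly_eq0.
(* Every remainder has size below [m], so the last column of the square matrix [M] is zero. *)
have : \det M == 0.
  rewrite -det_tr; apply/det0P; exists (delta_mx 0 (Ordinal m_gt0)).
    apply/eqP => /matrixP/(_ 0 (Ordinal m_gt0)); rewrite !mxE !eqxx => /eqP.
    by rewrite oner_eq0.
  rewrite -rowE; apply/rowP => i; rewrite !mxE nth_default //=.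
  by rewrite -ltnS prednK // (leq_ltn_trans _ m_gt0).
case/det0P => v vn0 vM.
pose c (k : nat) := if insub k is Some i then v 0 (i : 'I_m) else 0.
have cE (i : 'I_m) : c i = v 0 i by rewrite /c valK.
(* Pseudo-division multiplies [A k] by a power of the leading coefficient of [Q]; this nonzero
   factor is absorbed into the coefficients of the relation. *)
exists (fun k => c k * lead_coef Q ^+ scalp (A k) Q); split.
  case/rV0Pn: vn0 => k vk; exists k => //.
  by rewrite cE mulf_neq0 // expf_neq0 // lead_coef_eq0.
have : \sum_(k < m) c k *: r k = 0.
  apply/polyP => j; rewrite coef_sum coef0.
  have [ltj|lej] := ltnP j m; last first.
    apply: big1 => k _; rewrite coefZ nth_default ?mulr0 //.
    by rewrite (leq_trans (ltnW (szr k))).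
  move/rowP/(_ (Ordinal ltj)): vM; rewrite !mxE => vMj; rewrite -[RHS]vMj.
  by apply: eq_bigr => k _; rewrite coefZ cE mxE.
move/(congr1 (fps_eval f)); rewrite rmorph0 rmorph_sum => r0; rewrite -[RHS]r0.
by apply: eq_bigr => k _; rewrite /= fps_evalZ evr rmorphM mulrA.
Qed.

End Euler.

(** * Linear differential equations for algebraic series *)

Section DifferentialEquation.
Variable K : numFieldType.
Implicit Types (f : fps K) (Q : {poly {poly K}}).

(* A common factor of [Q] and its [Y]-derivative would contradict minimality,
   hence Bezout expresses a nonzero element of [K[X]] through the two. *)
Lemma separable_bezout f Q : Q != 0 -> fps_eval f Q = 0 ->
  (forall A : {poly {poly K}}, (size A < size Q)%N -> fps_eval f A = 0 -> A = 0) ->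
  exists2 R : {poly K}, R != 0 &
    exists v, fps_poly R = fps_eval f v * fps_eval f Q^`().
Proof.
move=> Qn0 evQ minQ; set Q' := Q^`(); pose g := gcdp Q Q'.
have szQ : (1 < size Q)%N.
  rewrite ltnNge; apply/negP => /size1_polyC QC; move: evQ Qn0.
  rewrite QC fps_evalC -(rmorph0 (@fps_poly K)) => /fps_poly_inj ->.
  by rewrite eqxx.
(* Characteristic zero: the degree times the leading coefficient of [Q] survives in the
   derivative. *)
have Q'n0 : Q' != 0.
  apply/eqP => /polyP/(_ (size Q).-2); rewrite coef_deriv coef0.
  case szE : (size Q) szQ => [|[|n]] //= _ /eqP; rewrite -mulr_natl mulf_eq0.
  rewrite -polyC1 -polyCMn polyC_eq0 pnatr_eq0 /= => /eqP lc0.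
  by case/eqP: Qn0; apply/eqP; rewrite -lead_coef_eq0 lead_coefE szE lc0.
have szg : (size g < size Q)%N.
  apply: leq_ltn_trans (lt_size_deriv Qn0); exact: Pdiv.Idomain.leq_gcdpr.
have gn0 : g != 0 by rewrite Pdiv.Idomain.gcdp_eq0 negb_and Qn0.
have [[u1 u2] /Pdiv.Idomain.eqpP[[c1 c2] /andP[/= c1n0 c2n0] bez]] := Pdiv.Idomain.Bezoutp Q Q'.
(* If the gcd is constant in [Y], evaluating the Bezout relation at [f] kills the term in [Q] and
   leaves the required identity. *)
have [szg1|szg1] := leqP (size g) 1.
  have gC := size1_polyC szg1; rewrite -/g gC in bez.
  exists (c2 * g`_0); first by rewrite mulf_neq0 // -polyC_eq0 -gC.
  exists (c1 *: u2); move/(congr1 (fps_eval f)): bez.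
  rewrite !fps_evalZ fps_evalC rmorphD !rmorphM /= evQ mulr0 add0r => <-.
  by rewrite mulrA.
(* Otherwise a nonzero multiple of [Q] by an element of [K[X]] splits into two factors of smaller
   degree, one of which vanishes at [f]. *)
have /Pdiv.Idomain.dvdpP[[c h] /= cn0 ch] := Pdiv.Idomain.dvdp_gcdl Q Q'.
rewrite -/g in ch.
have hn0 : h != 0.
  by apply: contra_neq Qn0 => h0; move/eqP: ch; rewrite h0 mul0r scale_poly_eq0 (negPf cn0) => /eqP.
have szh : (size h < size Q)%N.
  have := congr1 (fun A : {poly {poly K}} => size A) ch; rewrite /= size_scale // size_mul // => ->.
  by rewrite -(ltn_predK szg1) addnS /= -addn1 leq_add2l -ltnS (ltn_predK szg1).
have /fps_mul_eq0[/(minQ _ szh)/eqP|/(minQ _ szg)/eqP] : fps_eval f h * fps_eval f g = 0.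
- by rewrite -rmorphM -ch /= fps_evalZ evQ mulr0.
- by rewrite (negPf hn0).
- by rewrite (negPf gn0).
Qed.

(** The Bezout identity makes [R X f'] a polynomial in [f], so [R X d/dX] preserves the polynomials
    in [f]. These have finite rank over [K[X]], which forces a relation between the iterates on
    [f]. *)
Lemma algebraic_differential_equation f Q : Q != 0 -> fps_eval f Q = 0 ->
  exists (R : {poly K}) (m : nat) (p : nat -> {poly K}),
  [/\ R != 0, exists2 k, (k < m)%N & p k != 0 &
    \sum_(k < m) fps_poly (p k) * iter k (fun g => fps_poly R * fps_euler g) f = 0].
Proof.
move=> Q0n0 evQ0; have [{Q0n0 evQ0}Q [Qn0 evQ minQ]] := minimal_annihilator (ex_intro2 _ _ Q Q0n0 evQ0).
have [R Rn0 [v vE]] := separable_bezout Qn0 evQ minQ.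
(* Differentiating [Q(f) = 0] expresses the product of the [Y]-derivative at [f] with [X f'];
   multiplying by [v(f)] turns it into [R X f' = V(f)]. *)
pose V := - (v * map_poly (@poly_euler K) Q).
have VE : fps_poly R * fps_euler f = fps_eval f V.
  have /eqP := fps_euler_eval f Q; rewrite evQ.
  have -> : fps_euler 0 = 0 :> fps K by apply: funext => n; rewrite /fps_euler mul0rn.
  rewrite eq_sym addr_eq0 => /eqP QE.
  by rewrite vE rmorphN rmorphM /= QE mulrN opprK mulrA.
(* [T] lifts the operator [R X d/dX] from series to [K[X][Y]]. *)
pose T A := R *: map_poly (@poly_euler K) A + A^`() * V.
have TE A : fps_poly R * fps_euler (fps_eval f A) = fps_eval f (T A).
  rewrite fps_euler_eval mulrDr rmorphD rmorphM /= fps_evalZ -VE.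
  by rewrite mulrCA.
have iterE k : iter k (fun g => fps_poly R * fps_euler g) f = fps_eval f (iter k T 'X).
  by elim: k => [|k IH] /=; rewrite ?fps_evalX // IH TE.
have [p [pn0 pE]] := eval_linear_dependence (fun k => iter k T 'X) Qn0 evQ.
exists R, (size Q), p; split=> //; rewrite -[RHS]pE.
by apply: eq_bigr => k _; rewrite iterE.
Qed.

End DifferentialEquation.

(** * Growth of the coefficients of finitely valued series *)

Section Growth.
Variable K : archiNumFieldType.
Implicit Types (f g h : fps K) (p : {poly K}).

Definition finitely_valued f := exists s : seq K, forall n, f n \in s.

Lemma finitely_valued_bounded f : finitely_valued f -> exists H : K, forall n, `|f n| <= H.
Proof.
move=> [s fs]; exists (\sum_(x <- s) `|x|) => n.
rewrite (big_rem _ (fs n)) /= lerDl; apply: sumr_ge0 => x _.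
exact: normr_ge0.
Qed.

Lemma finitely_valued_poly p f : finitely_valued f -> finitely_valued (fps_poly p * f).
Proof.
move=> fv; elim/poly_ind: p => [|p c [s IH]].
  by exists [:: 0] => n; rewrite rmorph0 mul0r mem_seq1.
case: fv => t ft; exists [seq x + c * y | x <- 0 :: s, y <- t] => n.
have -> : (fps_poly (p * 'X + c%:P) * f) n =
    (if n is k.+1 then (fps_poly p * f) k else 0) + c * f n.
  by rewrite [p * _]mulrC rmorphD rmorphM mulrDl -mulrA fpsD fps_polyX_mul fps_polyC_mul.
apply: (allpairs_f (fun x y => x + c * y)) => //.
by case: n => [|n]; rewrite inE ?eqxx // IH orbT.
Qed.

(* [g n = n^k * h n + O(n^(k-1))], with a bound that makes sense at [k = 0] too. *)
Definition asymptotic (k : nat) h g := exists C : K, forall n,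
  `|g n - h n * n%:R ^+ k| * n.+1%:R <= C * n.+1%:R ^+ k.

Lemma asymptotic_refl f : asymptotic 0 f f.
Proof. by exists 0 => n; rewrite mulr1 subrr normr0 !mul0r. Qed.

Lemma asymptotic_euler k h g : asymptotic k h g -> asymptotic k.+1 h (fps_euler g).
Proof.
move=> [C gC]; exists C => n; rewrite /fps_euler -[g n *+ n]mulr_natr exprSr mulrA -mulrBl.
rewrite normrM normr_nat mulrAC exprSr [leRHS]mulrA.
by apply: ler_pM; rewrite ?mulr_ge0 // ler_nat.
Qed.

Lemma asymptoticD k h g h' g' :
  asymptotic k h g -> asymptotic k h' g' -> asymptotic k (h + h') (g + g').
Proof.
move=> [C gC] [C' gC']; exists (C + C') => n.
rewrite !fpsD mulrDl opprD addrACA mulrDl; apply: le_trans (lerD (gC n) (gC' n)).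
by rewrite -mulrDl ler_wpM2r // ler_normD.
Qed.

Lemma asymptoticC c k h g : asymptotic k h g ->
  asymptotic k (fps_poly c%:P * h) (fps_poly c%:P * g).
Proof.
move=> [C gC]; exists (`|c| * C) => n.
by rewrite !fps_polyC_mul -mulrA -mulrBr normrM -!mulrA ler_wpM2l.
Qed.

(** Subtraction-free form of [(m+1)^k - m^k <= k (m+1)^(k-1)], multiplied by [m+1] so that it makes
    sense at [k = 0]. *)
Lemma expn_succ_bound m k : (m.+1 ^ k.+1 <= m ^ k * m.+1 + k * m.+1 ^ k)%N.
Proof.
elim: k => [|k IH]; first by rewrite expn0 mul1n mul0n addn0.
rewrite expnS (leq_trans (leq_mul (leqnn m.+1) IH)) // mulnDr [(m.+1 * (k * _))%N]mulnCA -expnS.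
rewrite [(k.+1 * _)%N]mulSn addnA leq_add2r [leqLHS]mulSn mulnA -expnS addnC leq_add2l.
by rewrite expnSr leq_mul //; case: k {IH} => [|k]; rewrite ?expn0 ?leq_exp2r.
Qed.

(** The shift replaces [n^k] by [(n-1)^k]; as [h] is bounded, the change is of the order of the
    error term. *)
Lemma asymptoticX k h g : finitely_valued h -> asymptotic k h g ->
  asymptotic k (fps_poly 'X * h) (fps_poly 'X * g).
Proof.
move=> /finitely_valued_bounded[H hH] [C gC].
have C0 : 0 <= C.
  have := gC 0%N; rewrite expr1n !mulr1; apply: le_trans; exact: normr_ge0.
have H0 : 0 <= H by apply: le_trans (hH 0%N).
(* [H k] pays for the change of power, and the factor 2 for [m + 2 <= 2 (m + 1)]. *)
exists (2 * (C + H * k%:R)) => -[|m]; rewrite !fps_polyX_mul.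
  by rewrite mul0r subrr normr0 mul0r !mulr_ge0 ?addr_ge0 ?mulr_ge0 ?exprn_ge0.
set x := `|_|.
have xE : x * m.+1%:R <= (C + H * k%:R) * m.+1%:R ^+ k.
  have -> : x = `|(g m - h m * m%:R ^+ k) - h m * (m.+1%:R ^+ k - m%:R ^+ k)|.
    by rewrite /x mulrBr opprB addrA addrNK.
  apply: (@le_trans _ _ ((`|g m - h m * m%:R ^+ k| +
      `|h m| * (m.+1%:R ^+ k - m%:R ^+ k)) * m.+1%:R)).
    apply: ler_wpM2r => //; apply: (le_trans (ler_normB _ _)).
    rewrite lerD2l normrM [X in _ * X <= _]ger0_norm // subr_ge0.
    by rewrite lerXn2r ?nnegrE // ler_nat.
  rewrite mulrDl mulrDl; apply: lerD; first exact: gC.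
  rewrite -!mulrA; apply: ler_pM => //.
    by rewrite mulr_ge0 // subr_ge0 lerXn2r ?nnegrE // ler_nat.
  rewrite mulrBl lerBlDl -!natrX -!natrM -natrD ler_nat -expnSr.
  exact: expn_succ_bound.
apply: (@le_trans _ _ (2 * (x * m.+1%:R))).
  rewrite mulrCA; apply: ler_wpM2l; first exact: normr_ge0.
  rewrite -natrM ler_nat.
  by rewrite mul2n -addnn addSn ltnS leq_addl.
rewrite -mulrA; apply: ler_wpM2l => //; apply: (le_trans xE).
apply: ler_wpM2l; first by rewrite addr_ge0 // mulr_ge0.
by rewrite lerXn2r ?nnegrE // ler_nat.
Qed.

Lemma asymptotic_poly p k h g : finitely_valued h -> asymptotic k h g ->
  asymptotic k (fps_poly p * h) (fps_poly p * g).
Proof.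
move=> fv as_g; elim/poly_ind: p => [|p c IH].
  rewrite rmorph0 !mul0r; exists 0 => n.
  by rewrite fps0 mul0r subrr normr0 !mul0r.
rewrite [p * _]mulrC rmorphD rmorphM /= !mulrDl -!mulrA.
apply: asymptoticD; last exact: asymptoticC.
by apply: asymptoticX => //; apply: finitely_valued_poly.
Qed.

(** Boundedness of [h] makes [g] an [O(n^k)], which is within the error allowed at order [l]. *)
Lemma asymptotic_lower k l h g : (k < l)%N -> finitely_valued h ->
  asymptotic k h g -> asymptotic l 0 g.
Proof.
move=> ltkl /finitely_valued_bounded[H hH] [C gC].
have C0 : 0 <= C.
  have := gC 0%N; rewrite expr1n !mulr1; apply: le_trans; exact: normr_ge0.
have H0 : 0 <= H by apply: le_trans (hH 0%N).
exists (C + H) => n; rewrite fps0 mul0r subr0 mulrDl.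
rewrite -[g n](subrK (h n * n%:R ^+ k)).
apply: (@le_trans _ _ (`|g n - h n * n%:R ^+ k| * n.+1%:R + `|h n * n%:R ^+ k| * n.+1%:R)).
  by rewrite -mulrDl ler_wpM2r // ler_normD.
have n1 : 1 <= n.+1%:R :> K by rewrite ler1n.
apply: lerD.
  apply: (le_trans (gC n)); apply: ler_wpM2l => //.
  exact/ler_weXn2l/ltnW.
rewrite normrM -mulrA; apply: ler_pM => //; first by rewrite mulr_ge0.
rewrite ger0_norm ?exprn_ge0 //; apply: (@le_trans _ _ (n.+1%:R ^+ k.+1)).
  by rewrite exprSr ler_wpM2r // lerXn2r ?nnegrE // ler_nat.
exact: ler_weXn2l.
Qed.

(* The values of [h] are [O(1/n)] and taken from a finite set. *)
Lemma asymptotic_zero k h : finitely_valued h -> asymptotic k h 0 ->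
  exists N, forall n, (N <= n)%N -> h n = 0.
Proof.
move=> [s hs] [C hC].
have C0 : 0 <= C.
  have := hC 0%N; rewrite expr1n !mulr1; apply: le_trans; exact: normr_ge0.
(* The inverses also take finitely many values, so nonzero values of [h] are bounded away from 0;
   the convention [0^-1 = 0] allows one bound for all [n]. *)
have [M hM] : exists M : K, forall n, `|(h n)^-1| <= M.
  apply: (@finitely_valued_bounded (fun n => (h n)^-1)).
  by exists [seq x^-1 | x <- s] => n; apply: map_f.
have M0 : 0 <= M by apply: le_trans (hM 0%N).
(* For [n >= 1], [(n+1)^k <= 2^k n^k] gives [|h n| (n+1) <= C 2^k]; hence [h n != 0] forces
   [n + 1 <= B]. *)
pose B := C * 2 ^+ k * M.
have B0 : 0 <= B by rewrite !mulr_ge0 // exprn_ge0.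
exists (Num.Def.archi_bound B).+1 => n ltBn; apply/eqP/negPn/negP => hn0.
have n_gt0 : (0 < n)%N by apply: leq_trans ltBn.
have : `|h n| * n.+1%:R <= C * 2 ^+ k.
  rewrite -(@ler_pM2r _ (n%:R ^+ k)) ?exprn_gt0 ?ltr0n // -[leRHS]mulrA -exprMn.
  have := hC n; rewrite sub0r normrN normrM normrX normr_nat mulrAC => /le_trans; apply.
  apply: ler_wpM2l => //; rewrite lerXn2r ?nnegrE ?mulr_ge0 // -natrM ler_nat.
  by rewrite mul2n -addnn -addn1 leq_add2l.
rewrite -ler_pdivlMl ?normr_gt0 // => /(@le_trans _ _ _ _ B).
rewrite -normfV mulrC => /(_ (ler_wpM2l _ (hM n))).
rewrite mulr_ge0 ?exprn_ge0 // => /(_ isT) /le_lt_trans /(_ (archi_boundP B0)).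
by rewrite ltr_nat ltnNge leqW // ltnW.
Qed.

Lemma differential_equation_rational (R : {poly K}) m (p : nat -> {poly K}) f :
  R != 0 -> (exists2 k, (k < m)%N & p k != 0) -> finitely_valued f ->
  \sum_(k < m) fps_poly (p k) * iter k (fun g => fps_poly R * fps_euler g) f = 0 ->
  exists2 q, q != 0 & exists N, forall n, (N <= n)%N -> (fps_poly q * f) n = 0.
Proof.
set th := fun g => _; move=> Rn0 [k0 + pk0] fv.
have th_asym k : asymptotic k (fps_poly (R ^+ k) * f) (iter k th f).
  elim: k => [|k IH]; first by rewrite rmorph1 mul1r; exact: asymptotic_refl.
  rewrite exprS rmorphM /= -mulrA; apply: asymptotic_poly.
    exact: finitely_valued_poly.
  exact: asymptotic_euler.
(* All terms of order below [l] together are negligible at order [l]. *)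
have sum_asym l : asymptotic l 0 (\sum_(k < l) fps_poly (p k) * iter k th f).
  elim: l => [|l IH]; first by rewrite big_ord0; exact: asymptotic_refl.
  have fv0 : finitely_valued 0 by exists [:: 0] => n; rewrite mem_seq1.
  rewrite big_ord_recr /= -[X in asymptotic _ X]addr0; apply: asymptoticD.
    exact: asymptotic_lower IH.
  have fvR := finitely_valued_poly (R ^+ l) fv.
  exact: asymptotic_lower (finitely_valued_poly _ fvR) (asymptotic_poly (p l) fvR (th_asym l)).
(* The induction discards vanishing last terms until the highest nonzero [p m] is reached. *)
elim: m => // m IH ltk; rewrite big_ord_recr /=.
have [pm0|pmn0] := eqVneq (p m) 0.
  rewrite pm0 rmorph0 mul0r addr0; apply: IH.
  rewrite ltn_neqAle -ltnS ltk andbT; apply: contraNneq pk0 => ->.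
  by rewrite pm0.
(* The whole sum has main part [n^m] times the coefficients of [p m * R^m * f], and it is zero. *)
move=> sum0; exists (p m * R ^+ m); first by rewrite mulf_neq0 // expf_neq0.
apply: (@asymptotic_zero m); first exact: finitely_valued_poly.
rewrite -sum0 -[fps_poly _ * f]add0r; apply: asymptoticD => //.
rewrite rmorphM -mulrA; apply: asymptotic_poly => //.
exact: finitely_valued_poly.
Qed.

(** * Linear recurrences with finitely many values *)

Lemma fps_poly_mulE p f n : (size p <= n)%N ->
  (fps_poly p * f) n = \sum_(i < size p) p`_i * f (n - i)%N.
Proof.
move=> leSn; rewrite fpsM [RHS](big_ord_widen n.+1 (fun i => p`_i * f (n - i)%N)) 1?leqW //.
rewrite [LHS](bigID (fun i : 'I_n.+1 => (i < size p)%N)) /= [X in _ + X]big1 ?addr0 // => i.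
by rewrite -leqNgt => /(nth_default 0); rewrite /fps_poly => ->; rewrite mul0r.
Qed.

(** The lowest nonzero coefficient of [p] can be cancelled, so the recurrence determines each value
    from the preceding window of length [size p]. *)
Lemma recurrence_step p f N a b : p != 0 ->
  (forall n, (N <= n)%N -> (fps_poly p * f) n = 0) -> (N <= a)%N -> (N <= b)%N ->
  (forall i, (i < size p)%N -> f (a + i)%N = f (b + i)%N) ->
  f (a + size p)%N = f (b + size p)%N.
Proof.
move=> pn0 pf leNa leNb win; set S := size p in win *.
have ex : exists r, p`_r != 0.
  by exists S.-1; rewrite -lead_coefE lead_coef_eq0.
case: (ex_minnP ex) => r prn0 minr.
have ltrS : (r < S)%N by rewrite ltnNge; apply: contra prn0 => /leq_sizeP->.
have E c : (N <= c)%N -> \sum_(i < S) p`_i * f (c + (S + r - i))%N = 0.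
  move=> leNc; rewrite -[RHS](pf (c + (S + r))%N) ?(leq_trans leNc) ?leq_addr //.
  rewrite fps_poly_mulE ?(leq_trans (leq_addr r S)) ?leq_addl //.
  apply: eq_bigr => i _; rewrite addnBA //.
  by rewrite (leq_trans (ltnW (ltn_ord i))) ?leq_addr.
apply/eqP; rewrite -subr_eq0; apply/eqP/(mulfI prn0).
have := congr2 (fun x y => x - y) (E a leNa) (E b leNb).
rewrite /= -sumrB (bigD1 (Ordinal ltrS)) //= !addnK -mulrBr subrr mulr0.
rewrite big1 ?addr0 // => i; rewrite -val_eqE /= neq_ltn => /orP[ltir|ltri].
  have /eqP-> : p`_i == 0.
    by apply/negPn/negP => /minr; rewrite leqNgt ltir.
  by rewrite !mul0r subrr.
rewrite win ?subrr // ltn_subLR ?[(i + _)%N]addnC ?ltn_add2l //.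
by rewrite (leq_trans (ltnW (ltn_ord i))) ?leq_addr.
Qed.

Lemma window_repeats f S N : finitely_valued f ->
  exists a b, [/\ (N <= a)%N, (a < b)%N &
    forall i, (i < S)%N -> f (a + i)%N = f (b + i)%N].
Proof.
move=> [s fs].
(* A window is coded by the positions of its values in [s]; the codes form a finite type, so two of
   [#|T| + 1] windows agree. *)
pose W (n : nat) := [ffun i : 'I_S => inord (index (f (N + n + i)%N) s) : 'I_(size s).+1].
pose T := {ffun 'I_S -> 'I_(size s).+1}.
have W_eq a b : W a = W b -> forall i, (i < S)%N -> f (N + a + i)%N = f (N + b + i)%N.
  move=> /ffunP Wab i ltiS; have := Wab (Ordinal ltiS).
  rewrite !ffunE => /(congr1 val) /=; rewrite !inordK ?ltnS ?index_size // => ab.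
  by rewrite -[LHS](nth_index 0 (fs _)) -[RHS](nth_index 0 (fs _)) ab.
have /injectivePn[a [b neq_ab Wab]] : ~~ injectiveb (fun i : 'I_(#|T|.+1) => W i).
  by apply/negP => /injectiveP/leq_card; rewrite card_ord ltnn.
have := W_eq a b Wab; have := W_eq b a (esym Wab).
move: neq_ab; rewrite -val_eqE /= neq_ltn => /orP[lt|lt] Eba Eab.
  by exists (N + a)%N, (N + b)%N; rewrite ltn_add2l leq_addr.
by exists (N + b)%N, (N + a)%N; rewrite ltn_add2l leq_addr.
Qed.

(** Two equal windows beyond [N] stay equal when moved along by the recurrence, so their distance is
    a period. *)
Lemma rational_finitely_valued_periodic p f N : p != 0 -> finitely_valued f ->
  (forall n, (N <= n)%N -> (fps_poly p * f) n = 0) ->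
  exists M d, (1 <= d)%N /\ forall n, (M <= n)%N -> f (n + d)%N = f n.
Proof.
move=> pn0 fv pf; have [a [b [leNa ltab win]]] := window_repeats (size p) N fv.
have per k : f (a + k)%N = f (b + k)%N.
  elim/ltn_ind: k => k IH; have [|leSk] := ltnP k (size p); first exact: win.
  rewrite -(subnK leSk) !addnA; apply: (recurrence_step pn0 pf).
  - by rewrite (leq_trans leNa) // leq_addr.
  - by rewrite (leq_trans leNa) // (leq_trans (ltnW ltab)) // leq_addr.
  - by move=> i lti; rewrite -!addnA IH // -ltn_subRL subKn.
exists a, (b - a)%N; split; first by rewrite subn_gt0.
by move=> n /subnKC <-; rewrite per addnAC subnKC // ltnW.
Qed.

Theorem algebraic_finitely_valued_periodic f (Q : {poly {poly K}}) :
  Q != 0 -> fps_eval f Q = 0 -> finitely_valued f ->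
  exists M d, (1 <= d)%N /\ forall n, (M <= n)%N -> f (n + d)%N = f n.
Proof.
move=> Qn0 evQ fv; have [R [m [p [Rn0 pn0 eq0]]]] := algebraic_differential_equation Qn0 evQ.
have [q qn0 [N qf]] := differential_equation_rational Rn0 pn0 fv eq0.
exact: rational_finitely_valued_periodic qf.
Qed.

End Growth.

(** * Rescaled algebraic relations and generating series of periodic sequences *)

Section Evaluation.
Variable K : idomainType.
Implicit Types (f : fps K) (Q : {poly {poly K}}).

Lemma fps_sum (I : Type) (s : seq I) (F : I -> fps K) n :
  (\sum_(i <- s) F i) n = \sum_(i <- s) F i n.
Proof. by elim/big_rec2: _ => [//|i x f _ <-]; rewrite fpsD. Qed.

Lemma fps_evalE f Q m : (size Q <= m)%N ->
  fps_eval f Q = \sum_(k < m) fps_poly Q`_k * f ^+ k.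
Proof.
move=> leQm; rewrite /fps_eval (@horner_coef_wide _ m); last exact: leq_trans (size_poly _ _) _.
by apply: eq_bigr => k _; rewrite coef_map.
Qed.

(** Weighting the coefficient of [Y^k] by [c^(m-k)] gives [Q'(c f) = c^m Q(f)], with no division by
    [c]. *)
Lemma fps_eval_rescale f Q (c : {poly K}) : c != 0 -> Q != 0 -> fps_eval f Q = 0 ->
  exists2 Q' : {poly {poly K}}, Q' != 0 & fps_eval (fps_poly c * f) Q' = 0.
Proof.
move=> cn0 Qn0 evQ; set m := size Q; exists (\poly_(k < m) (Q`_k * c ^+ (m - k))).
  apply/eqP => /polyP/(_ m.-1); rewrite coef_poly coef0 prednK ?lt0n ?size_poly_eq0 // leqnn.
  by apply/eqP; rewrite mulf_neq0 ?expf_neq0 // -lead_coefE lead_coef_eq0.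
transitivity (fps_poly (c ^+ m) * fps_eval f Q); last by rewrite evQ mulr0.
rewrite (fps_evalE _ (size_poly _ _)) (@fps_evalE _ _ m) // mulr_sumr; apply: eq_bigr => k _.
rewrite coef_poly ltn_ord exprMn -rmorphXn /= mulrA -rmorphM mulrA -rmorphM.
by rewrite -[_ * c ^+ k]mulrA -exprD subnK ?[c ^+ m * _]mulrC // ltnW.
Qed.

Lemma fps_polyXn_mul d f n :
  (fps_poly 'X^d * f) n = if (n < d)%N then 0 else f (n - d)%N.
Proof.
elim: d n => [|d IH] n; first by rewrite rmorph1 mul1r subn0.
rewrite exprS rmorphM -mulrA fps_polyX_mul; case: n => [//|n].
by rewrite IH ltnS subSS.
Qed.

Lemma fps_const_mul (c : K) : fps_poly (1 - 'X) * (fun=> c : K) = fps_poly c%:P.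
Proof.
apply: funext => n; rewrite rmorphB rmorph1 mulrBl mul1r fpsD fpsN fps_polyX_mul.
by rewrite /fps_poly coefC; case: n => [|n]; rewrite ?subr0 ?subrr.
Qed.

(** The coefficients of the product are the differences [f n - f (n - d)], which vanish from [N + d]
    on. *)
Lemma fps_periodic_mul f N d :
  (forall n, (N <= n)%N -> f (n + d)%N = f n) ->
  fps_poly (1 - 'X^d) * f =
  fps_poly (\poly_(i < N + d) (f i - if (i < d)%N then 0 else f (i - d)%N)).
Proof.
move=> per; apply: funext => n.
rewrite rmorphB rmorph1 mulrBl mul1r fpsD fpsN fps_polyXn_mul /fps_poly coef_poly.
case: (ltnP n (N + d)) => // leNn; rewrite ltnNge (leq_trans (leq_addl _ _) leNn) /=.
rewrite -{1}(subnK (leq_trans (leq_addl N d) leNn)) per ?subrr //.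
by rewrite leq_subRL ?(leq_trans (leq_addl N d) leNn) // addnC.
Qed.

End Evaluation.

(** * The geometric realisation and the three cases *)

Section GeometricRealisation.
Variables (l1 l2 : algC) (w : nat -> letter).

Lemma geom_real_mul : fps_poly (1 - 'X) * (geom_real l1 l2 w : fps algC) =
  fps_poly 'X * (fun n => tile_len l1 l2 (w n)).
Proof.
apply: funext => n; rewrite rmorphB rmorph1 mulrBl mul1r fpsD fpsN !fps_polyX_mul.
case: n => [|n]; first by rewrite /geom_real big_ord0 subrr.
by rewrite /geom_real big_ord_recr addrAC subrr add0r.
Qed.

Lemma algebraic_fps_eval (f : series) : algebraic_over_QX f ->
  exists2 Q : {poly {poly algC}}, Q != 0 & fps_eval f Q = 0.
Proof.
move=> [Q [Qn0 Qf]]; exists (map_poly (map_poly (@ratr algC)) Q).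
  rewrite map_poly_eq0_id0 //.
  by rewrite map_poly_eq0 lead_coef_eq0.
rewrite (@fps_evalE _ _ _ (size Q)) ?size_poly //; apply: funext => n.
rewrite fps_sum -[RHS](Qf n); apply: eq_bigr => k _.
(* [smul] and [spoly] are convertible to the operations on [fps algC]; powers are matched by
   induction. *)
have -> : spow f k = (f : fps algC) ^+ k.
  by elim: {+}(k : nat) => // j IH; rewrite exprS -IH.
by rewrite coef_map_id0 ?map_poly0.
Qed.

Lemma algebraic_geom_real_periodic : l1 != l2 ->
  algebraic_over_QX (geom_real l1 l2 w) -> eventually_periodic w.
Proof.
move=> l12 /algebraic_fps_eval[Q Qn0 evQ].
have X1n0 : 1 - 'X != 0 :> {poly algC}.
  by apply/eqP => /polyP/(_ 0%N)/eqP; rewrite coefB coef1 coefX coef0 subr0 oner_eq0.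
(* This passes from [G] to [(1 - X) G], whose coefficients take finitely many values. *)
have [Q' Q'n0] := fps_eval_rescale X1n0 Qn0 evQ.
rewrite geom_real_mul => evQ'.
have fv : finitely_valued (fps_poly 'X * (fun n => tile_len l1 l2 (w n)) : fps algC).
  apply: finitely_valued_poly; exists [:: l1; l2] => n.
  by case: (w n); rewrite !inE eqxx ?orbT.
have [M [d [d_gt0 per]]] := algebraic_finitely_valued_periodic Q'n0 evQ' fv.
(* The factor [X] puts the length of [w n] at index [n + 1]; distinct lengths then identify the
   letters. *)
exists M, d; split=> // n leMn; have := per n.+1 (leqW leMn).
rewrite !fps_polyX_mul addSn.
case: (w (n + d)%N) (w n) => [] [] //= /eqP; first by rewrite (negPf l12).
by rewrite eq_sym (negPf l12).
Qed.

End GeometricRealisation.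

Theorem theorem4p9 (sigma : substitution) (w : nat -> letter) (l1 l2 : algC) :
  fixed_word sigma w -> 0 < l1 -> 0 < l2 ->
  let G : series := geom_real l1 l2 w in
  (* (a) G = l1 X / (1-X)^2 *)
  (l1 = l2 ->
     smul (spoly ((1 - 'X) ^+ 2)) G = spoly (l1 *: 'X)) /\
  (* (b) G = (l1-l2) X P /((1-X)(1-X^d)) + l1 X/(1-X)^2 *)
  (l1 != l2 -> eventually_periodic w ->
     exists (P : {poly rat}) (d : nat), (1 <= d)%N /\
       smul (spoly ((1 - 'X) ^+ 2 * (1 - 'X ^+ d))) G =
       spoly ((l1 - l2) *: ('X * map_poly ratr P * (1 - 'X))
              + l1 *: ('X * (1 - 'X ^+ d)))) /\
  (* (c) *)
  (l1 != l2 -> ~ eventually_periodic w -> transcendental_over_QX G).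
Proof.
move=> _ _ _ G; split; [|split].
- move=> l12; change (fps_poly ((1 - 'X) ^+ 2) * (G : fps algC) = fps_poly (l1 *: 'X)).
  rewrite expr2 rmorphM -mulrA geom_real_mul -mul_polyC mulrC.
  have -> : (fun n => tile_len l1 l2 (w n)) = (fun=> l1) :> fps algC.
    by apply: funext => n; rewrite -l12; case: (w n).
  by rewrite -mulrA [X in _ * X]mulrC fps_const_mul -rmorphM mulrC.
- move=> _ [N [d [d_gt0 per]]].
  (* With the indicator of [a2], the tile lengths are [l1 - (l1 - l2) b], so the periodic part has
     rational coefficients. *)
  pose b n : rat := if w n is a2 then 1 else 0.
  pose P := \poly_(i < N + d) (b i - if (i < d)%N then 0 else b (i - d)%N).
  pose B : fps algC := fun n => ratr (b n).
  have BP : fps_poly (1 - 'X^d) * B = fps_poly (map_poly ratr P).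
    rewrite (@fps_periodic_mul _ _ N) => [|n leNn]; last by rewrite /B /b per.
    congr fps_poly; apply/polyP => i; rewrite coef_map !coef_poly /=.
    by case: ifP => _; rewrite ?rmorph0 // rmorphB; case: ifP; rewrite ?rmorph0.
  have tileE : (fun n => tile_len l1 l2 (w n)) =
      ((fun=> l1) : fps algC) - fps_poly (l1 - l2)%:P * B :> fps algC.
    apply: funext => n; rewrite fpsD fpsN fps_polyC_mul /B /b.
    by case: (w n); rewrite ?rmorph0 ?rmorph1 ?mulr0 ?subr0 // mulr1 subKr.
  (* The sign compensates for the minus in [tileE]: [P] is the numerator of the series of [b] over
     [1 - X^d]. *)
  exists (- P), d; split=> //.
  change (fps_poly ((1 - 'X) ^+ 2 * (1 - 'X^d)) * (G : fps algC) = fps_poly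
    ((l1 - l2) *: ('X * map_poly ratr (- P) * (1 - 'X)) + l1 *: ('X * (1 - 'X^d)))).
  have -> : (1 - 'X) ^+ 2 * (1 - 'X^d) = ((1 - 'X) * (1 - 'X^d)) * (1 - 'X) :> {poly algC}.
    by rewrite expr2 mulrAC.
  rewrite rmorphM -mulrA geom_real_mul tileE -!mul_polyC.
  set c := (l1 - l2)%:P; rewrite [map_poly _ _]rmorphN rmorphD !rmorphM /= [fps_poly (- _)]rmorphN /= -BP -(fps_const_mul l1).
  ring.
- by move=> l12 np /(algebraic_geom_real_periodic l12).
Qed.
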